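(* Let $(\eta_k)_{k\ge0}$ and $(\theta_l)_{l\ge0}$ be sequences of pairwise distinct complex numbers with intertwining sequence $(H_j)_{j\ge1}$. Let $N\ge1$, let $n,m$ be the associated integers, $\mathcal{P}_{n,m}$ the associated polynomial space and $\Omega_N=\{H_1,\ldots,H_N\}$. Then the fundamental Lagrange polynomials $l^{(N)}_{H_k}$ exist, i.e. for all $k=1,\ldots,N$, $l^{(N)}_{H_k}\in\mathcal{P}_{n,m}$ and $l^{(N)}_{H_k}(H_l)=\delta_{k,l}$ for all $l=1,\ldots,N$. In addition, if $H_k=(\eta_p,\theta_q)$, then, writing $l=l^{(N)}_{(\eta_p,\theta_q)}(z,w)$, $E_p^a=\prod_{0\le j\le a,\,j\ne p}\frac{z-\eta_j}{\eta_p-\eta_j}$ and $F_q^b=\prod_{0\le i\le b,\,i\ne q}\frac{w-\theta_i}{\theta_q-\theta_i}$ (empty products equal $1$, empty sums equal $0$), for all $(z,w)\in\mathbb{C}^2$: (1) if $p+q=n$, or $p+q=n-1$ and $q\ge m+1$: $\ l=E_p^{p-1}F_q^{q-1}$; (2) if $p+q=n-1$ and $q=m$: $\ l=E_{n-m-1}^{n-m}F_m^{m-1}$; (3) if $p+q=n-1$ and $0\le q\le m-1$: $\ l=E_p^{p+1}F_q^{q-1}-E_p^{p-1}F_q^{q-1}+E_p^{p-1}F_q^{q+1}$; (4) if $0\le p+q\le n-2$, $0\le q\le m-1$ and $0\le p\le n-m-1$: $$l=E_p^{n-q}F_q^{q-1}-E_p^{n-q-1}F_q^{q-1}+E_p^{n-q-1}F_q^{q+1}+\sum_{r=1}^{m-q-1}\big[E_p^{n-q-r-1}F_q^{q+r+1}-E_p^{n-q-r-1}F_q^{q+r}\big]+\sum_{r=m-q}^{n-p-q-2}\big[E_p^{n-q-r-2}F_q^{q+r+1}-E_p^{n-q-r-2}F_q^{q+r}\big];$$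 (5) if $0\le p+q\le n-2$, $0\le q\le m-1$ and $p\ge n-m$: $$l=E_p^{n-q}F_q^{q-1}-E_p^{n-q-1}F_q^{q-1}+E_p^{n-q-1}F_q^{q+1}+\sum_{r=1}^{n-p-q-1}\big[E_p^{n-q-r-1}F_q^{q+r+1}-E_p^{n-q-r-1}F_q^{q+r}\big];$$ (6) if $p+q\le n-2$ and $q=m$: $$l=E_p^{n-m}F_m^{m-1}-E_p^{n-m-2}F_m^{m-1}+E_p^{n-m-2}F_m^{m+1}+\sum_{r=1}^{n-m-p-2}\big[E_p^{n-m-r-2}F_m^{m+r+1}-E_p^{n-m-r-2}F_m^{m+r}\big];$$ (7) if $p+q\le n-2$ and $q\ge m+1$: $$l=E_p^{n-q-1}F_q^{q-1}-E_p^{n-q-2}F_q^{q-1}+E_p^{n-q-2}F_q^{q+1}+\sum_{r=1}^{n-p-q-2}\big[E_p^{n-q-r-2}F_q^{q+r+1}-E_p^{n-q-r-2}F_q^{q+r}\big].$$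
   Context: Order $\mathbb{N}^2$ ($0\in\mathbb{N}$) by $(k_1,l_1)\le(k_2,l_2)$ iff $k_1+l_1<k_2+l_2$, or $k_1+l_1=k_2+l_2$ and $k_1\ge k_2$; this enumerates $\mathbb{N}^2$ as $(k(1),l(1)),(k(2),l(2)),\ldots=(0,0),(1,0),(0,1),(2,0),(1,1),\ldots$. Put $e_j(z,w)=z^{k(j)}w^{l(j)}$. The intertwining sequence of $(\eta_k)_{k\ge0}$ and $(\theta_l)_{l\ge0}$ is $H_j=(\eta_{k(j)},\theta_{l(j)})$, $j\ge1$. Let $N_n=\frac{(n+1)(n+2)}2$ for $n\ge-1$ (so $N_{-1}=0$). For $N\ge1$, the associated integers $n\ge0$ and $0\le m\le n$ are defined by $N_{n-1}<N\le N_n$ and $m=N-N_{n-1}-1$, and $\mathcal{P}_{n,m}=\mathrm{span}\{e_j:1\le j\le N\}$; it has dimension $N$ and is spanned by all polynomials in $(z,w)$ of total degree at most $n-1$ and the monomials $z^n,z^{n-1}w,\ldots,z^{n-m}w^m$. The polynomial $l^{(N)}_{H_k}$ with $H_k=(\eta_p,\theta_q)$ is also written $l^{(N)}_{(\eta_p,\theta_q)}$. *)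

(* Defs.v *)
(* The complex numbers are R[i], for an arbitrary R : realType. *)
From HB Require Import structures.
From mathcomp Require Import all_boot all_order all_algebra.
From mathcomp Require Import reals complex.
From mathcomp Require Export mpoly.
From mathcomp Require Import zify.

Set Implicit Arguments.
Unset Strict Implicit.
Unset Printing Implicit Defensive.

Import Order.TTheory GRing.Theory Num.Theory.
Local Open Scope ring_scope.

Definition grle (a b : nat * nat) : bool :=
  ((a.1 + a.2 < b.1 + b.2) || ((a.1 + a.2 == b.1 + b.2) && (b.1 <= a.1)))%N.

Definition next_pair (a : nat * nat) : nat * nat :=
  if a.1 is k.+1 then (k, a.2.+1) else (a.2.+1, 0%N).

(* The pair (k(j), l(j)), for j >= 1 (the value at j = 0 is junk);
   [kl_grle] and [kl_surj] show that this is the enumeration of nat * nat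
   in increasing order for [grle]. *)
Definition kl (j : nat) : nat * nat := iter j.-1 next_pair (0%N, 0%N).

Lemma grle_trans (b a c : nat * nat) : grle a b -> grle b c -> grle a c.
Proof. rewrite /grle; lia. Qed.

Lemma grle_next (a : nat * nat) : grle a (next_pair a) && ~~ grle (next_pair a) a.
Proof. by case: a => -[|k] l; rewrite /grle /=; lia. Qed.

Lemma grle_iter (d : nat) (a : nat * nat) : grle a (iter d next_pair a).
Proof.
elim: d => [|d IHd] /=; first by rewrite /grle; lia.
by apply: grle_trans IHd _; case/andP: (grle_next (iter d next_pair a)).
Qed.

Lemma kl_grle (i j : nat) : (0 < i)%N -> (0 < j)%N ->
  grle (kl i) (kl j) = (i <= j)%N.
Proof.
case: i j => [|i] [|j] // _ _; rewrite /kl /= ltnS.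
have [le_ij|lt_ji] := leqP i j.
  by rewrite -(subnK le_ij) iterD grle_iter.
apply/negP => Hij.
have := grle_iter (i - j.+1) (next_pair (iter j next_pair (0, 0)%N)).
rewrite -iterS -iterD subnK // => Hji.
case/andP: (grle_next (iter j next_pair (0, 0)%N)) => _ /negP; apply.
exact: grle_trans Hji Hij.
Qed.

Lemma kl_surj (a : nat * nat) : exists2 j : nat, (0 < j)%N & kl j = a.
Proof.
suff: exists i, iter i next_pair (0, 0)%N = a by case=> i Hi; exists i.+1.
case: a => k l; have [s def_s] : exists s, s = (k + l)%N by exists (k + l)%N.
elim: s k l def_s => [|s IHs] k l; last first.
  elim: l k => [|l IHl] k.
    rewrite addn0 => <-; have [|i Hi] := IHs 0%N s; first by [].
    by exists i.+1; rewrite iterS Hi.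
  rewrite addnS -addSn => /IHl [i Hi].
  by exists i.+1; rewrite iterS Hi.
by move=> def_s; exists 0%N => /=; congr pair; lia.
Qed.

Definition mono (R : realType) (j : nat) : {mpoly R[i][2]} :=
  'X_ord0 ^+ (kl j).1 * 'X_ord_max ^+ (kl j).2.

Definition intertwine (R : realType) (eta theta : nat -> R[i]) (j : nat) :
  R[i] * R[i] := (eta (kl j).1, theta (kl j).2).

Definition eval2 (R : realType) (l : {mpoly R[i][2]}) (x : R[i] * R[i]) : R[i] :=
  l.@[tnth [tuple x.1; x.2]].

Definition Nn (n : nat) : nat := (n.+1 * n.+2)./2.

(* N_{n-1}, with N_{-1} = 0 *)
Definition Nn_pred (n : nat) : nat := if n is n'.+1 then Nn n' else 0%N.

Definition associated (N n m : nat) : Prop :=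
  (Nn_pred n < N <= Nn n)%N /\ m = (N - Nn_pred n - 1)%N.

Lemma associated_ex (N : nat) : (0 < N)%N -> exists n m : nat, associated N n m.
Proof.
move=> N_gt0; have exN : exists n, (N <= Nn n)%N.
  by exists N; rewrite /Nn -divn2 leq_divRL //; nia.
have [n le_Nn min_n] := ex_minnP exN; exists n, (N - Nn_pred n - 1)%N.
split=> //; rewrite le_Nn andbT; case: n le_Nn min_n => [|n] // _ min_n.
by rewrite ltnNge; apply/negP => /min_n; rewrite ltnn.
Qed.

(* For the integers n, m associated with N, this is membership in P_{n,m}. *)
Definition in_span_mono (R : realType) (N : nat) (l : {mpoly R[i][2]}) : Prop :=
  exists c : nat -> R[i], l = \sum_(1 <= j < N.+1) c j *: mono R j.

Definition fund_lagrange (R : realType) (eta theta : nat -> R[i])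
    (N k : nat) (l : {mpoly R[i][2]}) : Prop :=
  in_span_mono N l /\
  forall j : nat, (1 <= j <= N)%N ->
    eval2 l (intertwine eta theta j) = (k == j)%:R.

(* The product over 0 <= j <= a, j <> p, of (t - x_j) / (x_p - x_j).
   The bound a is an integer, since a = -1 does occur; the product over an
   empty range is 1. *)
Definition lagr1 (R : realType) (x : nat -> R[i]) (p : nat) (a : int)
    (t : R[i]) : R[i] :=
  if a is Posz b then \prod_(0 <= j < b.+1 | j != p) ((t - x j) / (x p - x j))
  else 1.

(* Main.v *)
(* The nodes H_1, ..., H_N are the (eta_a, theta_b) with (a, b) in a staircase
   (a downset of nat * nat), whose row b has h b elements, h nonincreasing.  With
   E_k and F_k the products of the first k factors of the univariate Lagrange
   polynomials at eta_p and theta_q, all the formulas (1)-(7) are instances of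
     E_(h q) F_(q+1) + \sum_(q < c < d) E_(h c) (F_(c+1) - F_c),
   where d is the height of column p.  Each product spans a rectangle contained
   in the staircase; and at (eta_a, theta_b) every E_(h c) that is multiplied by
   a nonzero factor equals (a == p)%:R, since then c <= b and a < h b <= h c, so
   that the sum telescopes to (a == p)%:R * F_d(theta_b).  Uniqueness follows
   from existence, as a right inverse of a square matrix is a left inverse. *)
Require Import Defs.
From mathcomp Require Import all_boot all_order all_algebra.
From mathcomp Require Import reals complex.
From mathcomp Require Import zify ring.

Set Implicit Arguments.
Unset Strict Implicit.
Unset Printing Implicit Defensive.

Import Order.TTheory GRing.Theory Num.Theory.
Local Open Scope ring_scope.

(** * Univariate Lagrange factors *)

(** The bound is exclusive, hence one more than the superscript of $E_p^a$: the superscript $-1$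
    becomes [k = 0], and [k] can be the length of a row. *)
Definition lagr_prod (K : fieldType) (x : nat -> K) (p k : nat) (t : K) : K :=
  \prod_(0 <= j < k | j != p) ((t - x j) / (x p - x j)).

Lemma lagr1E (R : realType) (x : nat -> R[i]) (p k : nat) (a : int) (t : R[i]) :
  a = k%:Z - 1 -> lagr1 x p a t = lagr_prod x p k t.
Proof.
move=> ->; case: k => [|k]; first by rewrite /lagr_prod big_geq.
by have -> : k.+1%:Z - 1 = Posz k by lia.
Qed.

Section LagrangeFactors.
Variables (K : fieldType) (x : nat -> K).

Lemma lagr_prodS_diag (p : nat) (t : K) :
  lagr_prod x p p.+1 t = lagr_prod x p p t.
Proof.
rewrite /lagr_prod !(big_mkcond (fun j => j != p)) /=.
by rewrite big_nat_recr //= eqxx mulr1.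
Qed.

Lemma lagr_prod_node (p k a : nat) : injective x -> (a < k)%N ->
  lagr_prod x p k (x a) = (a == p)%:R.
Proof.
move=> x_inj lt_ak; have [->|a_neq_p] := eqVneq a p.
  rewrite /lagr_prod big1 // => j j_neq_p; rewrite divff // subr_eq0.
  by rewrite (inj_eq x_inj) eq_sym.
apply/eqP; rewrite prodf_seq_eq0; apply/hasP; exists a.
  by rewrite mem_index_iota.
by rewrite a_neq_p subrr mul0r /=.
Qed.

(** As [p < k], the index [p] is skipped, which leaves [k - 1] linear factors and degree at most
    [k - 1]. *)
Lemma lagr_prod_poly (p k : nat) : (p < k)%N ->
  exists u : nat -> K, forall t, lagr_prod x p k t = \sum_(i < k) u i * t ^+ i.
Proof.
move=> lt_pk.
pose P := \prod_(j <- index_iota 0 k | j != p)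
            ((x p - x j)^-1 *: ('X - (x j)%:P)).
have sizeP : (size P <= k)%N.
  have -> : P = \prod_(j < k | j != Ordinal lt_pk)
                  ((x p - x j)^-1 *: ('X - (x j)%:P)).
    by rewrite /P big_mkord.
  apply: leq_trans (size_prod_leq _ _) _.
  have card_k : #|[pred j : 'I_k | j != Ordinal lt_pk]| = k.-1.
    by have := cardC1 (Ordinal lt_pk); rewrite card_ord.
  (* Each factor has size at most 2, and [(2 * (k - 1)).+1 - (k - 1) = k]. *)
  apply: (@leq_trans ((\sum_(j < k | j != Ordinal lt_pk) 2).+1 - k.-1)).
    rewrite [X in (_ - X)%N]card_k leq_sub2r // ltnS; apply: leq_sum => j _.
    by apply: leq_trans (size_scale_leq _ _) _; rewrite size_XsubC.
  by rewrite sum_nat_const card_k; lia.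
exists (fun i => P`_i) => t; rewrite -(horner_coef_wide t sizeP).
rewrite /P horner_prod; apply: eq_bigr => j _.
by rewrite hornerZ hornerXsubC mulrC.
Qed.

End LagrangeFactors.

(** * Lagrange functions of a staircase *)

(* The nodes are the [(x a, y b)] with [a < h b]: row [b] has [h b] nodes and
   column [p] has [d] nodes. *)
Definition staircase_lagrange (K : fieldType) (x y : nat -> K) (h : nat -> nat)
    (d p q : nat) (z w : K) : K :=
  lagr_prod x p (h q) z * lagr_prod y q q.+1 w +
  \sum_(q.+1 <= c < d)
     lagr_prod x p (h c) z * (lagr_prod y q c.+1 w - lagr_prod y q c w).

(** The case of a node at the top of its column: the correction sum is empty. *)
Lemma staircase_lagrange_last (K : fieldType) (x y : nat -> K)
    (h : nat -> nat) (p q : nat) (z w : K) :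
  staircase_lagrange x y h q.+1 p q z w =
  lagr_prod x p (h q) z * lagr_prod y q q w.
Proof. by rewrite /staircase_lagrange big_geq // addr0 lagr_prodS_diag. Qed.

(** Isolates the term [c = q.+1] and reindexes the others by [c = r + q.+1], which is the shape of
    formulas (3) to (7). *)
Lemma staircase_lagrange_split (K : fieldType) (x y : nat -> K)
    (h : nat -> nat) (d p q : nat) (z w : K) :
  (q.+1 < d)%N ->
  staircase_lagrange x y h d p q z w =
  lagr_prod x p (h q) z * lagr_prod y q q w
  - lagr_prod x p (h q.+1) z * lagr_prod y q q w
  + lagr_prod x p (h q.+1) z * lagr_prod y q q.+2 w
  + \sum_(1 <= r < d - q.+1)
      (lagr_prod x p (h (r + q.+1)%N) z * lagr_prod y q (r + q.+1).+1 w
       - lagr_prod x p (h (r + q.+1)%N) z * lagr_prod y q (r + q.+1) w).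
Proof.
move=> lt_qd; rewrite /staircase_lagrange big_ltn //.
rewrite -[X in \sum_(X <= _ < d) _]add1n big_addn lagr_prodS_diag.
under eq_bigr => r _ do rewrite mulrBr.
ring.
Qed.

Lemma staircase_lagrange_node (K : fieldType) (x y : nat -> K) (h : nat -> nat)
    (d p q a b : nat) :
  injective x -> injective y -> {homo h : i j / (i <= j)%N >-> (j <= i)%N} ->
  (forall c, (p < h c)%N = (c < d)%N) -> (q < d)%N -> (a < h b)%N ->
  staircase_lagrange x y h d p q (x a) (y b) = ((a, b) == (p, q))%:R.
Proof.
move=> x_inj y_inj h_homo hd lt_qd lt_a.
have E_node c : (c <= b)%N -> lagr_prod x p (h c) (x a) = (a == p)%:R.
  move=> le_cb; rewrite lagr_prod_node //.
  exact: leq_trans lt_a (h_homo _ _ le_cb).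
have -> : staircase_lagrange x y h d p q (x a) (y b) =
          (a == p)%:R * lagr_prod y q d (y b).
  rewrite /staircase_lagrange.
  have -> : lagr_prod y q d (y b) = lagr_prod y q q.+1 (y b) +
     \sum_(q.+1 <= c < d) (lagr_prod y q c.+1 (y b) - lagr_prod y q c (y b)).
    by rewrite telescope_sumr // addrC subrK.
  rewrite mulrDr mulr_sumr; congr (_ + _).
    have [/E_node -> //|lt_bq] := leqP q b.
    by rewrite (lagr_prod_node _ y_inj) ?leqW // (ltn_eqF lt_bq) !mulr0.
  (* For [b < c] both factors in [w] already have their final value [(b == q)%:R], so their
     difference is 0. *)
  apply: eq_bigr => c _; have [/E_node -> //|lt_bc] := leqP c b.
  by rewrite !(lagr_prod_node _ y_inj) ?leqW // subrr !mulr0.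
rewrite xpair_eqE; have [a_p|_] /= := eqVneq a p; last by rewrite mul0r.
(* With [a = p], the condition [a < h b] becomes [b < d] through [hd]. *)
by rewrite mul1r lagr_prod_node // -hd -a_p.
Qed.

(** * Evaluation of polynomials spanned by the first monomials *)

Section Span.
Variables (R : realType) (N : nat).
Implicit Types (f g : R[i] * R[i] -> R[i]).

Lemma eval2_sum (c : nat -> R[i]) (x : R[i] * R[i]) :
  eval2 (\sum_(1 <= j < N.+1) c j *: mono R j) x =
  \sum_(1 <= j < N.+1) c j * eval2 (mono R j) x.
Proof.
by rewrite /eval2 raddf_sum; apply: eq_bigr => j _ /=; rewrite mevalZ.
Qed.

Lemma eval2_mono (j : nat) (x : R[i] * R[i]) :
  eval2 (mono R j) x = x.1 ^+ (kl j).1 * x.2 ^+ (kl j).2.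
Proof. by rewrite /eval2 /mono rmorphM !rmorphXn /= !mevalXU. Qed.

(** Phrased for functions, so that products of a factor in [z] and a factor in [w] need not be
    lifted to bivariate polynomials. *)
Definition spanned f : Prop :=
  exists2 l : {mpoly R[i][2]}, in_span_mono N l & eval2 l =1 f.

Lemma eq_spanned f g : f =1 g -> spanned f -> spanned g.
Proof. by move=> fg [l ? lf]; exists l => // x; rewrite lf fg. Qed.

Lemma spanned0 : spanned (fun=> 0).
Proof.
exists 0; last by move=> x; rewrite /eval2 raddf0.
by exists (fun=> 0); rewrite big1 // => j _; rewrite scale0r.
Qed.

Lemma spannedD f g : spanned f -> spanned g -> spanned (fun x => f x + g x).
Proof.
move=> [lf [c ->] ef] [lg [c' ->] eg].
exists (\sum_(1 <= j < N.+1) (c j + c' j) *: mono R j); first by eexists.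
move=> x; rewrite -ef -eg !eval2_sum -big_split.
by apply: eq_bigr => j _; rewrite mulrDl.
Qed.

Lemma spannedZ a f : spanned f -> spanned (fun x => a * f x).
Proof.
move=> [lf [c ->] ef].
exists (\sum_(1 <= j < N.+1) (a * c j) *: mono R j); first by eexists.
move=> x; rewrite -ef !eval2_sum mulr_sumr.
by apply: eq_bigr => j _; rewrite mulrA.
Qed.

Lemma spannedB f g : spanned f -> spanned g -> spanned (fun x => f x - g x).
Proof.
move=> sf /(spannedZ (-1)) sg; apply: eq_spanned (spannedD sf sg) => x.
by rewrite mulN1r.
Qed.

Lemma spanned_sum (I : eqType) (r : seq I) (F : I -> R[i] * R[i] -> R[i]) :
  (forall i, i \in r -> spanned (F i)) -> spanned (fun x => \sum_(i <- r) F i x).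
Proof.
elim: r => [|i r IHr] Fr.
  by apply: eq_spanned spanned0 => x; rewrite big_nil.
apply: eq_spanned (spannedD (Fr i (mem_head _ _)) (IHr _)) => [x|j jr].
  by rewrite big_cons.
by apply: Fr; rewrite in_cons jr orbT.
Qed.

Lemma spanned_mono j : (1 <= j <= N)%N ->
  spanned (fun x => x.1 ^+ (kl j).1 * x.2 ^+ (kl j).2).
Proof.
move=> jN; exists (mono R j); last exact: eval2_mono.
exists (fun i => (i == j)%:R).
rewrite (bigD1_seq j) ?iota_uniq ?mem_index_iota //= eqxx scale1r.
by rewrite big1 ?addr0 // => i /negPf ->; rewrite scale0r.
Qed.

Lemma spanned_rectangle (x y : nat -> R[i]) (p q k k' : nat) :
  (p < k)%N -> (q < k')%N ->
  (forall a b, (a < k)%N -> (b < k')%N ->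
     exists2 j, (1 <= j <= N)%N & kl j = (a, b)) ->
  spanned (fun u => lagr_prod x p k u.1 * lagr_prod y q k' u.2).
Proof.
move=> /(lagr_prod_poly x)[u Eu] /(lagr_prod_poly y)[v Ev] rect.
apply: (@eq_spanned (fun t => \sum_(i < k) \sum_(j < k')
           (u i * v j) * (t.1 ^+ i * t.2 ^+ j))).
  move=> t; rewrite Eu Ev mulr_suml; apply: eq_bigr => i _.
  by rewrite mulr_sumr; apply: eq_bigr => j _; rewrite mulrACA.
apply: spanned_sum => i _; apply: spanned_sum => j _; apply: spannedZ.
have [c cN def_c] := rect i j (ltn_ord i) (ltn_ord j).
by apply: eq_spanned (spanned_mono cN) => t; rewrite def_c.
Qed.

Lemma spanned_staircase (x y : nat -> R[i]) (h : nat -> nat) (d p q : nat) :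
  {homo h : i j / (i <= j)%N >-> (j <= i)%N} ->
  (forall a b, (a < h b)%N -> exists2 j, (1 <= j <= N)%N & kl j = (a, b)) ->
  (forall c, (p < h c)%N = (c < d)%N) -> (q < d)%N ->
  spanned (fun u => staircase_lagrange x y h d p q u.1 u.2).
Proof.
move=> h_homo hN hd lt_qd.
(* The rectangle [h c] by [k] lies in the staircase: [b < k <= c.+1] gives [b <= c], hence
   [a < h c <= h b]. *)
have rect c k : (q < k <= c.+1)%N -> (c < d)%N ->
    spanned (fun u => lagr_prod x p (h c) u.1 * lagr_prod y q k u.2).
  case/andP=> lt_qk le_kc lt_cd; apply: spanned_rectangle; rewrite ?hd //.
  move=> a b lt_a lt_b; apply: hN; apply: leq_trans lt_a (h_homo _ _ _).
  by rewrite -ltnS (leq_trans lt_b).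
(* Here [c = q] and [k = q.+1]; the bound [q.+1], rather than the equivalent [q], is what meets
   [q < k]. *)
apply: spannedD; first by apply: rect => //; rewrite ltnS leqnn.
apply: spanned_sum => c; rewrite mem_index_iota => /andP[lt_qc lt_cd].
have := spannedB (@rect c c.+1 _ lt_cd) (@rect c c _ lt_cd).
rewrite lt_qc leqnn leqW // leqnSn => /(_ isT isT).
by apply: eq_spanned => u; rewrite mulrBr.
Qed.

End Span.

(* A right inverse of the square matrix of the values of the first [N] monomials
   at the nodes is also a left inverse. *)
Lemma fund_lagrange_inj (R : realType) (eta theta : nat -> R[i]) (N : nat)
    (l1 l2 : {mpoly R[i][2]}) :
  (forall k, (1 <= k <= N)%N -> exists l, fund_lagrange eta theta N k l) ->
  in_span_mono N l1 -> in_span_mono N l2 ->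
  (forall j, (1 <= j <= N)%N ->
     eval2 l1 (intertwine eta theta j) = eval2 l2 (intertwine eta theta j)) ->
  l1 = l2.
Proof.
move=> exl [c1 ->] [c2 ->] eq12.
pose V := \matrix_(i < N, j < N) eval2 (mono R j.+1) (intertwine eta theta i.+1).
pose col (c : nat -> R[i]) := \col_(j < N) c j.+1.
have Vcol c i : (V *m col c) i 0 =
    eval2 (\sum_(1 <= j < N.+1) c j *: mono R j) (intertwine eta theta i.+1).
  rewrite eval2_sum big_add1 big_mkord mxE; apply: eq_bigr => j _.
  by rewrite !mxE mulrC.
(* The columns of [C] are the coefficients of the assumed Lagrange polynomials. *)
have [C VC] : exists C : 'M_N, V *m C = 1%:M.
  have /fin_all_exists[C HC] : forall k : 'I_N, exists c, forall i : 'I_N,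
      (V *m col c) i 0 = (i == k)%:R.
    move=> k; have [|l [[c ->] lk]] := exl k.+1; first by rewrite ltn_ord.
    by exists c => i; rewrite Vcol lk ?ltn_ord // eqSS eq_sym.
  exists (\matrix_(j < N, k < N) C k j.+1); apply/matrixP => i k.
  rewrite !mxE -HC mxE; apply: eq_bigr => j _; rewrite !mxE; congr (_ * _).
have V_inj (u v : 'cV_N) : V *m u = V *m v -> u = v.
  by move/(congr1 (mulmx C)); rewrite !mulmxA (mulmx1C VC) !mul1mx.
have /V_inj eq_c : V *m col c1 = V *m col c2.
  by apply/matrixP => i j; rewrite ord1 !Vcol eq12 // ltn_ord.
rewrite !big_add1 /= !big_mkord; apply: eq_bigr => j _; congr (_ *: _).
by have /matrixP/(_ j 0) := eq_c; rewrite !mxE.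
Qed.

(** * The staircase enumerated by [kl] *)

Lemma kl_inj (i j : nat) : (0 < i)%N -> (0 < j)%N -> kl i = kl j -> i = j.
Proof.
move=> i_gt0 j_gt0 eq_kl; apply/eqP.
rewrite eqn_leq -(kl_grle i_gt0) // -(kl_grle j_gt0) // eq_kl.
by rewrite /grle eqxx leqnn orbT.
Qed.

Lemma iter_next_pair (n m : nat) : (m <= n)%N ->
  iter m next_pair (n, 0%N) = ((n - m)%N, m).
Proof.
elim: m => [|m IHm] le_mn; first by rewrite subn0.
by rewrite iterS (IHm (ltnW le_mn)) -(subnSK le_mn).
Qed.

Lemma Nn_predS (n : nat) : Nn_pred n.+1 = (Nn_pred n + n.+1)%N.
Proof. case: n => [|n] //=; rewrite /Nn; nia. Qed.

Lemma iter_next_pair_Nn_pred (n : nat) :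
  iter (Nn_pred n) next_pair (0, 0)%N = (n, 0%N).
Proof.
elim: n => // n IHn.
(* From [(n, 0)], [n] steps lead to [(0, n)] and one more to [(n.+1, 0)]. *)
by rewrite Nn_predS addnC iterD IHn iterS iter_next_pair // subnn.
Qed.

Lemma associated_le (N n m : nat) : associated N n m -> (m <= n)%N.
Proof. by case=> + ->; have := Nn_predS n; rewrite /=; lia. Qed.

Lemma kl_associated (N n m : nat) : associated N n m -> kl N = ((n - m)%N, m).
Proof.
move=> Nnm; have le_mn := associated_le Nnm.
have -> : N = (m + Nn_pred n).+1 by case: Nnm; lia.
by rewrite /kl /= iterD iter_next_pair_Nn_pred iter_next_pair.
Qed.

(** Row [b] reaches total degree [n] if [b <= m], and only [n - 1] otherwise. *)
Definition row_size (n m b : nat) : nat := (n.+1 - b - (m < b))%N.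

Definition column_size (n m a : nat) : nat := (n - a + (n - a <= m))%N.

Lemma row_size_homo (n m : nat) :
  {homo row_size n m : i j / (i <= j)%N >-> (j <= i)%N}.
Proof. by move=> i j; rewrite /row_size; lia. Qed.

(** Rows and columns describe the same staircase. For [a > n] truncated subtraction would give
    [column_size] the value 1 instead of 0. *)
Lemma lt_row_size (n m a b : nat) : (a <= n)%N ->
  (a < row_size n m b)%N = (b < column_size n m a)%N.
Proof. by rewrite /row_size /column_size; lia. Qed.

(** The last pair is [kl N = (n - m, m)], so [j <= N] means degree below [n], or degree [n] with
    second exponent at most [m]. *)
Lemma associated_kl_le (N n m j : nat) :
  (0 < N)%N -> associated N n m -> (0 < j)%N ->
  (j <= N)%N = ((kl j).1 < row_size n m (kl j).2)%N.
Proof.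
move=> N_gt0 Nnm j_gt0; rewrite -kl_grle // (kl_associated Nnm) /grle /row_size.
have := associated_le Nnm; case: (kl j) => a b /=; lia.
Qed.

Lemma fund_lagrange_staircase (R : realType) (eta theta : nat -> R[i])
    (N n m k : nat) :
  injective eta -> injective theta -> associated N n m -> (1 <= k <= N)%N ->
  exists2 l : {mpoly R[i][2]}, fund_lagrange eta theta N k l &
    forall z w, eval2 l (z, w) = staircase_lagrange eta theta (row_size n m)
                    (column_size n m (kl k).1) (kl k).1 (kl k).2 z w.
Proof.
move=> eta_inj theta_inj Nnm /andP[k_gt0 le_kN].
have N_gt0 := leq_trans k_gt0 le_kN.
have lt_p : ((kl k).1 < row_size n m (kl k).2)%N.
  by rewrite -(associated_kl_le N_gt0).
have le_pn : ((kl k).1 <= n)%N by move: lt_p; rewrite /row_size; lia.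
have hd c := lt_row_size m c le_pn.
have lt_q : ((kl k).2 < column_size n m (kl k).1)%N by rewrite -hd.
have [|l l_span el] :=
  spanned_staircase (N := N) eta theta (@row_size_homo n m) _ hd lt_q.
  move=> a b lt_a; have [j j_gt0 def_j] := kl_surj (a, b).
  by exists j => //; rewrite j_gt0 (associated_kl_le N_gt0 Nnm) // def_j.
exists l => [|z w]; last exact: el.
split=> // j /andP[j_gt0 le_jN]; rewrite el.
rewrite staircase_lagrange_node // -?(associated_kl_le N_gt0) //.
  rewrite -!surjective_pairing; congr (nat_of_bool _)%:R.
  by apply/eqP/eqP => [/kl_inj->|->].
exact: row_size_homo.
Qed.

(** * Identification with the seven explicit formulas *)

Ltac match_factor := symmetry; apply: lagr1E; rewrite /row_size; lia.

Theorem proposition3 (R : realType) (eta theta : nat -> R[i])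
    (eta_inj : injective eta) (theta_inj : injective theta)
    (N n m : nat) (N_ge1 : (1 <= N)%N) (Nnm : associated N n m) :
  (forall k : nat, (1 <= k <= N)%N ->
     exists l : {mpoly R[i][2]}, fund_lagrange eta theta N k l)
  /\
  (forall (k : nat) (l : {mpoly R[i][2]}) (p q : nat),
     (1 <= k <= N)%N ->
     fund_lagrange eta theta N k l ->
     intertwine eta theta k = (eta p, theta q) ->
     forall z w : R[i],
     let E (p : nat) (a : int) : R[i] := lagr1 eta p a z in
     let F (q : nat) (b : int) : R[i] := lagr1 theta q b w in
     (* (1) *)
     ((p + q = n \/ (p + q + 1 = n /\ m + 1 <= q))%N ->
        eval2 l (z, w) = E p (p%:Z - 1) * F q (q%:Z - 1))
     /\
     (* (2) *)
     ((p + q + 1 = n /\ q = m)%N ->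
        eval2 l (z, w) = E (n - m - 1)%N (n%:Z - m%:Z) * F m (m%:Z - 1))
     /\
     (* (3) *)
     ((p + q + 1 = n /\ q + 1 <= m)%N ->
        eval2 l (z, w) =
          E p (p%:Z + 1) * F q (q%:Z - 1)
          - E p (p%:Z - 1) * F q (q%:Z - 1)
          + E p (p%:Z - 1) * F q (q%:Z + 1))
     /\
     (* (4) *)
     ((p + q + 2 <= n /\ q + 1 <= m /\ p + m + 1 <= n)%N ->
        eval2 l (z, w) =
          E p (n%:Z - q%:Z) * F q (q%:Z - 1)
          - E p (n%:Z - q%:Z - 1) * F q (q%:Z - 1)
          + E p (n%:Z - q%:Z - 1) * F q (q%:Z + 1)
          + \sum_(1 <= r < m - q)
              (E p (n%:Z - q%:Z - r%:Z - 1) * F q (q%:Z + r%:Z + 1)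
               - E p (n%:Z - q%:Z - r%:Z - 1) * F q (q%:Z + r%:Z))
          + \sum_(m - q <= r < n - p - q - 1)
              (E p (n%:Z - q%:Z - r%:Z - 2) * F q (q%:Z + r%:Z + 1)
               - E p (n%:Z - q%:Z - r%:Z - 2) * F q (q%:Z + r%:Z)))
     /\
     (* (5) *)
     ((p + q + 2 <= n /\ q + 1 <= m /\ n <= p + m)%N ->
        eval2 l (z, w) =
          E p (n%:Z - q%:Z) * F q (q%:Z - 1)
          - E p (n%:Z - q%:Z - 1) * F q (q%:Z - 1)
          + E p (n%:Z - q%:Z - 1) * F q (q%:Z + 1)
          + \sum_(1 <= r < n - p - q)
              (E p (n%:Z - q%:Z - r%:Z - 1) * F q (q%:Z + r%:Z + 1)
               - E p (n%:Z - q%:Z - r%:Z - 1) * F q (q%:Z + r%:Z)))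
     /\
     (* (6) *)
     ((p + q + 2 <= n /\ q = m)%N ->
        eval2 l (z, w) =
          E p (n%:Z - m%:Z) * F m (m%:Z - 1)
          - E p (n%:Z - m%:Z - 2) * F m (m%:Z - 1)
          + E p (n%:Z - m%:Z - 2) * F m (m%:Z + 1)
          + \sum_(1 <= r < n - m - p - 1)
              (E p (n%:Z - m%:Z - r%:Z - 2) * F m (m%:Z + r%:Z + 1)
               - E p (n%:Z - m%:Z - r%:Z - 2) * F m (m%:Z + r%:Z)))
     /\
     (* (7) *)
     ((p + q + 2 <= n /\ m + 1 <= q)%N ->
        eval2 l (z, w) =
          E p (n%:Z - q%:Z - 1) * F q (q%:Z - 1)
          - E p (n%:Z - q%:Z - 2) * F q (q%:Z - 1)
          + E p (n%:Z - q%:Z - 2) * F q (q%:Z + 1)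
          + \sum_(1 <= r < n - p - q - 1)
              (E p (n%:Z - q%:Z - r%:Z - 2) * F q (q%:Z + r%:Z + 1)
               - E p (n%:Z - q%:Z - r%:Z - 2) * F q (q%:Z + r%:Z)))).
Proof.
have exl k : (1 <= k <= N)%N -> exists l, fund_lagrange eta theta N k l.
  by case/(fund_lagrange_staircase eta_inj theta_inj Nnm) => l; exists l.
split=> // k l p q kN lk [] /eta_inj kp /theta_inj kq z w E F.
have [l' l'k el'] := fund_lagrange_staircase eta_inj theta_inj Nnm kN.
(* By uniqueness it suffices to treat the staircase polynomial. *)
have -> : l = l'.
  case: lk l'k => [l_span lk] [l'_span l'k].
  by apply: (fund_lagrange_inj exl) => // j jN; rewrite lk ?l'k.
have lt_p : (p < row_size n m q)%N.
  by case/andP: kN => k_gt0; rewrite (associated_kl_le N_ge1 Nnm) // kp kq.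
rewrite {}el' kp kq {kN lk l'k}; rewrite /row_size in lt_p.
do 6?[split].
- move=> pq; have -> : column_size n m p = q.+1 by rewrite /column_size; lia.
  rewrite staircase_lagrange_last.
  (* The node also ends its row; dropping the skipped factor [j = p] gives the superscript $p-1$. *)
  have -> : row_size n m q = p.+1 by rewrite /row_size; lia.
  by rewrite lagr_prodS_diag; congr (_ * _); match_factor.
- case=> pq qm; have -> : column_size n m p = q.+1 by rewrite /column_size; lia.
  rewrite staircase_lagrange_last -qm.
  have -> : (n - q - 1 = p)%N by lia.
  by congr (_ * _); match_factor.
- case=> pq qm.
  rewrite staircase_lagrange_split; last by rewrite /column_size; lia.
  (* Column [p] has height [q.+2]: only the isolated term [c = q.+1] remains. *)
  rewrite [X in _ + X]big_geq ?addr0; last by rewrite /column_size; lia.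
  have -> : row_size n m q.+1 = p.+1 by rewrite /row_size; lia.
  by rewrite lagr_prodS_diag; congr (_ * _ - _ * _ + _ * _); match_factor.
- case=> pq [qm pm].
  rewrite staircase_lagrange_split; last by rewrite /column_size; lia.
  have -> : (column_size n m p - q.+1 = n - p - q - 1)%N.
    by rewrite /column_size; lia.
  (* Row [r + q.+1] reaches degree [n] exactly when [r < m - q], so the superscripts of [E] drop by
     one more from there on. *)
  rewrite (@big_cat_nat _ _ _ (m - q)%N); try lia.
  rewrite !addrA; congr (_ * _ - _ * _ + _ * _ + _ + _);
    try by match_factor.
    by apply: eq_big_nat => r r_range; congr (_ * _ - _ * _); match_factor.
  by apply: eq_big_nat => r r_range; congr (_ * _ - _ * _); match_factor.
- case=> pq [qm pm].
  rewrite staircase_lagrange_split; last by rewrite /column_size; lia.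
  have -> : (column_size n m p - q.+1 = n - p - q)%N.
    by rewrite /column_size; lia.
  (* Column [p] has height [n - p + 1 <= m + 1], so every row involved reaches degree [n] and the
     sum is not cut. *)
  congr (_ * _ - _ * _ + _ * _ + _);
    try by match_factor.
  by apply: eq_big_nat => r r_range; congr (_ * _ - _ * _); match_factor.
- case=> pq qm.
  rewrite staircase_lagrange_split -?qm; last by rewrite /column_size; lia.
  have -> : (column_size n q p - q.+1 = n - q - p - 1)%N.
    by rewrite /column_size; lia.
  (* Row [q = m] is the last to reach degree [n], so the superscript of [E] falls by two at the next
     row. *)
  congr (_ * _ - _ * _ + _ * _ + _);
    try by match_factor.
  by apply: eq_big_nat => r r_range; congr (_ * _ - _ * _); match_factor.
- case=> pq qm.
  rewrite staircase_lagrange_split; last by rewrite /column_size; lia.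
  have -> : (column_size n m p - q.+1 = n - p - q - 1)%N.
    by rewrite /column_size; lia.
  congr (_ * _ - _ * _ + _ * _ + _);
    try by match_factor.
  by apply: eq_big_nat => r r_range; congr (_ * _ - _ * _); match_factor.
Qed.
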